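(* Fix a point $S\in\mathbb{R}^3$ and a constant $m>0$. There is a constant $M>0$ such that the following holds for every motion $x:\mathbb{R}\to\mathbb{R}^3\setminus\{S\}$ of an object $O$ that satisfies $$x''(t)=-\,m\,\frac{x(t)-S}{|x(t)-S|^3}\qquad (t\in\mathbb{R})$$ and whose orbit is an ellipse $E$: if $X$ is the length of the major axis of $E$ and $T$ is the length of time it takes $O$ to revolve once around $S$, then $$\frac{X^{3/2}}{T}=M .$$
   Context: An object subject only to a force directed towards $S$ satisfying an inverse square law is one whose acceleration at distance $r$ from $S$ is $m/r^2$ directed towards $S$, for a positive constant $m$. Circles count as ellipses. The major axis of an ellipse is the chord passing through its two foci (a diameter, in the case of a circle). The paper writes the conclusion as $X^{3/2}\sim T$, where $A\sim B$ for varying quantities $A,B$ means that $A/B$ equals some fixed constant $M$. *)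

(* Defs.v *)
From Stdlib Require Import Reals.
From Coquelicot Require Import Coquelicot.
Open Scope R_scope.

(* Coquelicot's norm on a product is [sqrt (norm x ^ 2 + norm y ^ 2)], so [norm]
   on [R3] is the Euclidean norm. *)
Definition R3 : NormedModule R_AbsRing :=
  prod_NormedModule R_AbsRing
    (prod_NormedModule R_AbsRing R_NormedModule R_NormedModule) R_NormedModule.

Definition dot (u v : R3) : R :=
  fst (fst u) * fst (fst v) + snd (fst u) * snd (fst v) + snd u * snd v.

Definition edist (P Q : R3) : R := norm (minus P Q).

Definition is_second_derivative (x a : R -> R3) : Prop :=
  exists v : R -> R3,
    (forall t, is_derive x t (v t)) /\ (forall t, is_derive v t (a t)).

Definition inverse_square_motion (S : R3) (m : R) (x : R -> R3) : Prop :=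
  (forall t, x t <> S) /\
  is_second_derivative x
    (fun t => scal (- m) (scal (/ edist (x t) S ^ 3) (minus (x t) S))).

Definition orbit (x : R -> R3) (P : R3) : Prop := exists t, x t = P.

(* [n] is a normal vector of the plane of the ellipse and [d] is the constant sum
   of the distances to the foci; [F1 = F2] gives the circles. *)
Definition ellipse_with_foci (E : R3 -> Prop) (F1 F2 : R3) : Prop :=
  exists (n : R3) (d : R),
    n <> zero /\ dot n (minus F2 F1) = 0 /\ edist F1 F2 < d /\
    forall P, E P <-> dot n (minus P F1) = 0 /\ edist P F1 + edist P F2 = d.

Definition is_ellipse (E : R3 -> Prop) : Prop :=
  exists F1 F2, ellipse_with_foci E F1 F2.

Definition on_segment (P Q A : R3) : Prop :=
  exists k, 0 <= k <= 1 /\ A = plus P (scal k (minus Q P)).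

(* The foci are determined by the set [E] up to order.  For a circle, the chords
   through the foci are the diameters. *)
Definition major_axis_length (E : R3 -> Prop) (X : R) : Prop :=
  exists F1 F2 P Q,
    ellipse_with_foci E F1 F2 /\ E P /\ E Q /\ P <> Q /\
    on_segment P Q F1 /\ on_segment P Q F2 /\ X = edist P Q.

(* [theta] is a continuous polar angle of [x] about [S], in a plane through [S]
   with orthonormal basis [u], [v]. *)
Definition polar_angle (S : R3) (x : R -> R3) (theta : R -> R) : Prop :=
  (forall t, continuous theta t) /\
  exists u v : R3,
    dot u u = 1 /\ dot v v = 1 /\ dot u v = 0 /\
    forall t, minus (x t) S =
      scal (edist (x t) S)
        (plus (scal (cos (theta t)) u) (scal (sin (theta t)) v)).

(* Starting at time [t0], the angle swept out about [S] first reaches a full turn,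
   in either direction, after time [T]. *)
Definition revolves_once (S : R3) (x : R -> R3) (t0 T : R) : Prop :=
  0 < T /\
  exists theta : R -> R,
    polar_angle S x theta /\
    Rabs (theta (t0 + T) - theta t0) = 2 * PI /\
    forall s, 0 <= s < T -> Rabs (theta (t0 + s) - theta t0) < 2 * PI.

(* Main.v *)
(* In the orbital plane the angular momentum [h] and the Laplace vector are conserved,
   so the orbit satisfies [r * (1 + f) = l] with [f = e1 * cos th + e2 * sin th] and
   [l = h^2 / m].  A full turn meets every direction; this forces [e1^2 + e2^2 < 1] and
   puts both apsides on the orbit.  The orbit then has diameter [2 * l / k^2], with
   [k = sqrt (1 - e1^2 - e2^2)], and the major axis of any ellipse is its diameter, so
   [X = 2 * l / k^2] whatever foci are used to describe the orbit.  Since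
   [th' = h / r^2], Kepler's mean anomaly grows at the constant rate [k^3 * h / l^2] and
   changes by [2 * PI] in one turn, so [T = 2 * PI * l^2 / (k^3 * |h|)].  The ratio is
   [sqrt (2 * m) / PI]. *)

Require Import Defs.
From Stdlib Require Import Reals Lra Psatz.
From Coquelicot Require Import Coquelicot.
Open Scope R_scope.

(** * Euclidean distance and the diameter of an ellipse *)

Lemma edist_dot (P Q : R3) : edist P Q = sqrt (dot (minus P Q) (minus P Q)).
Proof.
destruct P as [[p1 p2] p3], Q as [[q1 q2] q3].
assert (H : forall w : R3, norm w = sqrt (dot w w)).
{ intros [[a b] c].
  change (sqrt (sqrt (Rabs a ^ 2 + Rabs b ^ 2) ^ 2 + Rabs c ^ 2) =
    sqrt (a * a + b * b + c * c)).
  rewrite !pow2_abs, pow2_sqrt by nra. f_equal; ring. }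
apply H.
Qed.

Lemma edist_sym (P Q : R3) : edist P Q = edist Q P.
Proof. unfold edist. rewrite <- norm_opp. now rewrite opp_minus. Qed.

Lemma edist_triangle (P A Q : R3) : edist P Q <= edist P A + edist A Q.
Proof.
unfold edist. rewrite (minus_trans A P Q).
apply norm_triangle.
Qed.

Lemma on_segment_edist (P Q A : R3) :
  on_segment P Q A -> edist P A + edist A Q = edist P Q.
Proof.
intros [k [Hk ->]].
destruct P as [[p1 p2] p3], Q as [[q1 q2] q3].
rewrite !edist_dot.
unfold dot, minus, plus, opp, scal; simpl.
unfold plus, opp, scal, mult; simpl. unfold mult; simpl.
set (D := sqrt (_ * _ + _ * _ + _ * _)) at 3.
match goal with |- sqrt ?a + sqrt ?b = D =>
  replace (sqrt a) with (k * D); [replace (sqrt b) with ((1 - k) * D); [ring|]|] end;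
unfold D.
- rewrite <- (sqrt_Rsqr (1 - k)) at 1 by lra.
  rewrite <- sqrt_mult_alt by apply Rle_0_sqr. unfold Rsqr; f_equal; ring.
- rewrite <- (sqrt_Rsqr k) at 1 by lra.
  rewrite <- sqrt_mult_alt by apply Rle_0_sqr. unfold Rsqr; f_equal; ring.
Qed.

(** Half the sum of the triangle inequalities through the two foci. *)
Lemma edist_le_focal_sum (F1 F2 P Q : R3) (d : R) :
  edist P F1 + edist P F2 = d -> edist Q F1 + edist Q F2 = d -> edist P Q <= d.
Proof.
intros HP HQ.
pose proof (edist_triangle P F1 Q). pose proof (edist_triangle P F2 Q).
rewrite (edist_sym F1 Q) in *. rewrite (edist_sym F2 Q) in *. lra.
Qed.

(** Adding the two segment equations for the chord through the foci shows that its length is the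
    focal sum [d], which bounds every chord. This characterizes [X] by the set [E] alone,
    independently of the foci chosen. *)
Lemma major_axis_diameter (E : R3 -> Prop) (X : R) :
  major_axis_length E X ->
  (forall P Q, E P -> E Q -> edist P Q <= X) /\
  exists P Q, E P /\ E Q /\ edist P Q = X.
Proof.
intros (F1 & F2 & P & Q & (n & d & _ & _ & _ & HE) & HP & HQ & _ & H1 & H2 & ->).
apply on_segment_edist in H1; apply on_segment_edist in H2.
rewrite (edist_sym F1 Q) in H1; rewrite (edist_sym F2 Q) in H2.
pose proof (proj1 (HE P) HP). pose proof (proj1 (HE Q) HQ).
split; [|now exists P, Q].
intros A B HA HB.
apply (edist_le_focal_sum F1 F2).
- apply HE in HA. lra.
- apply HE in HB. lra.
Qed.

(** * Constant rates, directions and continuous polar angles *)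

Lemma constant_derivative (f : R -> R) (c : R) :
  (forall t, is_derive f t c) -> forall a b, f b - f a = c * (b - a).
Proof.
intros H a b.
destruct (MVT_gen f a b (fun _ => c)) as [z [_ Hz]]; auto.
intros t _. apply derivable_continuous_pt. exists c. now apply is_derive_Reals.
Qed.

Lemma unit_vector_angle (a c s : R) :
  c * c + s * s = 1 ->
  exists d, 0 <= d <= 2 * PI /\ cos (a + d) = c /\ sin (a + d) = s.
Proof.
intros H.
pose proof (sin2_cos2 a) as Ha. unfold Rsqr in Ha.
(* [(c', s')] is [(c, s)] rotated by [- a], so [d] is sought as its angle. *)
set (c' := c * cos a + s * sin a). set (s' := s * cos a - c * sin a).
assert (H' : c' * c' + s' * s' = 1).
{ unfold c', s'. transitivity ((c * c + s * s) * (sin a * sin a + cos a * cos a)); [ring|].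
  rewrite H, Ha; ring. }
assert (Hb : -1 <= c' <= 1) by nra.
assert (Hd : exists d, 0 <= d <= 2 * PI /\ cos d = c' /\ sin d = s').
{ pose proof (acos_bound c') as B. pose proof (cos_acos c' Hb) as C.
  pose proof (sin_acos c' Hb) as D.
  replace (1 - c'²) with (s'²) in D by (unfold Rsqr; lra).
  rewrite sqrt_Rsqr_abs in D.
  (* [acos] only yields a nonnegative sine; the lower half circle needs the reflected angle. *)
  destruct (Rle_dec 0 s') as [p|p].
  - exists (acos c'). rewrite Rabs_pos_eq in D by lra. repeat split; lra.
  - exists (2 * PI - acos c'). rewrite Rabs_left in D by lra.
    rewrite cos_minus, sin_minus, cos_2PI, sin_2PI. repeat split; lra. }
destruct Hd as (d & Hd & C & D). exists d. split; [exact Hd|].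
rewrite cos_plus, sin_plus, C, D. unfold c', s'.
split.
- transitivity (c * (sin a * sin a + cos a * cos a)); [ring|]. rewrite Ha; ring.
- transitivity (s * (sin a * sin a + cos a * cos a)); [ring|]. rewrite Ha; ring.
Qed.

(** By the intermediate value theorem [th] takes every value in an interval of length [2 * PI],
    whichever way the turn goes. *)
Lemma full_turn_all_directions (th : R -> R) (t0 t1 c s : R) :
  (forall t, continuous th t) -> Rabs (th t1 - th t0) = 2 * PI ->
  c * c + s * s = 1 -> exists t, cos (th t) = c /\ sin (th t) = s.
Proof.
intros Hc Ht H.
assert (Hc' : continuity th).
{ intro t. apply continuity_pt_filterlim, Hc. }
assert (K : forall y, Rmin (th t0) (th t1) <= y <= Rmax (th t0) (th t1) ->
  exists t, th t = y).
{ intros y Hy. destruct (IVT_gen th t0 t1 y Hc' Hy) as [t [_ E]]. now exists t. }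
assert (Hmm : exists a, Rmin (th t0) (th t1) = a /\ Rmax (th t0) (th t1) = a + 2 * PI).
{ pose proof PI_RGT_0. revert Ht. unfold Rabs, Rmin, Rmax.
  destruct Rcase_abs; destruct Rle_dec; intros; try lra; eexists; (split; [reflexivity|lra]). }
destruct Hmm as (a & E1 & E2). rewrite E1, E2 in K.
destruct (unit_vector_angle a c s H) as (d & Hd & C & D).
destruct (K (a + d)) as [t E]; [lra|].
exists t. now rewrite E.
Qed.

(** The angle is assumed only continuous, so its smoothness must come from the coordinates: locally
    it is a constant plus [atan] of the cross product over the dot product of the positions at [t]
    and [s], where the radii cancel. *)
Lemma polar_angle_derivative (p q p' q' r th : R -> R) :
  (forall t, 0 < r t) -> (forall t, continuous th t) ->
  (forall t, p t = r t * cos (th t)) -> (forall t, q t = r t * sin (th t)) ->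
  (forall t, is_derive p t (p' t)) -> (forall t, is_derive q t (q' t)) ->
  forall t, is_derive th t ((p t * q' t - q t * p' t) / (r t * r t)).
Proof.
intros Hr Hth Hp Hq Dp Dq t.
pose proof (sin2_cos2 (th t)) as Ht. unfold Rsqr in Ht.
assert (HR : p t * p t + q t * q t = r t * r t).
{ rewrite Hp, Hq. transitivity (r t * r t * (sin (th t) * sin (th t) + cos (th t) * cos (th t))); [ring|].
  rewrite Ht; ring. }
pose proof (Hr t) as Hrt.
(* Near [t] the angle differs from [th t] by less than a quarter turn. *)
apply (is_derive_ext_loc (fun s => th t + atan ((p t * q s - q t * p s) / (p t * p s + q t * q s)))).
- assert (Hn : locally t (fun s => Rabs (th s - th t) < PI / 2)).
  { pose proof PI2_RGT_0 as hpi.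
    exact (proj1 (filterlim_locally th (th t)) (Hth t) (mkposreal _ hpi)). }
  revert Hn. apply filter_imp. intros s Hs.
  apply Rabs_def2 in Hs.
  assert (Hcos : 0 < cos (th s - th t)) by (apply cos_gt_0; lra).
  pose proof (Hr s) as Hrs.
  replace ((p t * q s - q t * p s) / (p t * p s + q t * q s)) with (tan (th s - th t)).
  + rewrite atan_tan by lra. apply Rplus_minus.
  + rewrite !Hp, !Hq. unfold tan. revert Hcos. rewrite sin_minus, cos_minus. intro Hcos.
    field. split; [|lra].
    replace (r t * cos (th t) * (r s * cos (th s)) + r t * sin (th t) * (r s * sin (th s)))
      with (r t * r s * (cos (th s) * cos (th t) + sin (th s) * sin (th t))) by ring.
    apply Rgt_not_eq, Rmult_lt_0_compat; [nra|exact Hcos].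
- assert (Hnz : p t * p t + q t * q t <> 0) by nra.
  auto_derive.
  + repeat split; try (eexists; eauto; fail); auto.
  + change (Derive (fun s => p s) t) with (Derive p t).
    change (Derive (fun s => q s) t) with (Derive q t).
    rewrite (is_derive_unique _ _ _ (Dp t)), (is_derive_unique _ _ _ (Dq t)).
    rewrite <- HR. field. repeat split; nra.
Qed.

(** * Conservation of angular momentum and of the Laplace vector *)

(* The vector [(e1, e2)] is the Laplace-Runge-Lenz vector divided by [m]. *)
Lemma kepler_conserved (m : R) (p q p' q' r : R -> R) :
  0 < m -> (forall t, 0 < r t) ->
  (forall t, p t * p t + q t * q t = r t * r t) ->
  (forall t, is_derive p t (p' t)) -> (forall t, is_derive q t (q' t)) ->
  (forall t, is_derive p' t (- m * (/ r t ^ 3 * p t))) ->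
  (forall t, is_derive q' t (- m * (/ r t ^ 3 * q t))) ->
  exists h e1 e2, forall t,
    p t * q' t - q t * p' t = h /\ r t + e1 * p t + e2 * q t = h ^ 2 / m.
Proof.
intros hm Hr HR Dp Dq Dp' Dq'.
assert (Ep : forall t, Derive (fun s => p s) t = p' t)
  by (intro; apply is_derive_unique, Dp).
assert (Eq : forall t, Derive (fun s => q s) t = q' t)
  by (intro; apply is_derive_unique, Dq).
assert (Ep' : forall t, Derive (fun s => p' s) t = - m * (/ r t ^ 3 * p t))
  by (intro; apply is_derive_unique, Dp').
assert (Eq' : forall t, Derive (fun s => q' s) t = - m * (/ r t ^ 3 * q t))
  by (intro; apply is_derive_unique, Dq').
assert (Dr : forall t, is_derive r t ((p t * p' t + q t * q' t) / r t)).
{ intro t. pose proof (Hr t).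
  apply (is_derive_ext (fun s => sqrt (p s * p s + q s * q s))).
  - intro s. rewrite HR. apply sqrt_square. pose proof (Hr s); lra.
  - pose proof (HR t). auto_derive.
    + repeat split; try (eexists; eauto; fail). nra.
    + rewrite Ep, Eq, HR, sqrt_square by lra. field. lra. }
assert (Er : forall t, Derive (fun s => r s) t = (p t * p' t + q t * q' t) / r t)
  by (intro; apply is_derive_unique, Dr).
assert (Hh : forall a b, p b * q' b - q b * p' b - (p a * q' a - q a * p' a) = 0 * (b - a)).
{ apply (constant_derivative (fun t => p t * q' t - q t * p' t) 0). intro t.
  auto_derive; [repeat split; eexists; eauto|].
  rewrite Ep, Eq, Ep', Eq'. ring. }
set (h := p 0 * q' 0 - q 0 * p' 0).
assert (Ht : forall t, p t * q' t - q t * p' t = h).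
{ intro t. pose proof (Hh 0 t). unfold h. lra. }
(* [H1] and [H2] treat the two components of velocity cross angular momentum, divided by [m], minus
   the radial unit vector. *)
assert (H1 : forall a b, (q' b * h / m - p b / r b) - (q' a * h / m - p a / r a) = 0 * (b - a)).
{ apply (constant_derivative (fun t => q' t * h / m - p t / r t) 0). intro t.
  pose proof (Hr t).
  auto_derive; [repeat split; try lra; eexists; eauto|].
  rewrite Ep, Er, Eq', <- (Ht t).
  (* The numerator equals [p' * (p^2 + q^2 - r^2)], which vanishes by the hypothesis [HR]. *)
  transitivity ((p t * (p t * p' t + q t * q' t)
    - p' t * (r t * r t) - q t * (p t * q' t - q t * p' t)) / r t ^ 3).
  { field; lra. }
  rewrite <- HR. field; lra. }
assert (H2 : forall a b, (- p' b * h / m - q b / r b) - (- p' a * h / m - q a / r a) = 0 * (b - a)).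
{ apply (constant_derivative (fun t => - p' t * h / m - q t / r t) 0). intro t.
  pose proof (Hr t).
  auto_derive; [repeat split; try lra; eexists; eauto|].
  rewrite Eq, Er, Ep', <- (Ht t).
  transitivity ((q t * (p t * p' t + q t * q' t)
    - q' t * (r t * r t) + p t * (p t * q' t - q t * p' t)) / r t ^ 3).
  { field; lra. }
  rewrite <- HR. field; lra. }
exists h, (q' 0 * h / m - p 0 / r 0), (- p' 0 * h / m - q 0 / r 0).
intro t. split; [apply Ht|].
replace (q' 0 * h / m - p 0 / r 0) with (q' t * h / m - p t / r t) by (pose proof (H1 0 t); lra).
replace (- p' 0 * h / m - q 0 / r 0) with (- p' t * h / m - q t / r t) by (pose proof (H2 0 t); lra).
pose proof (Hr t).
(* Pairing the conserved vector with the position [(p, q)] gives the conic equation. *)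
transitivity (r t + (p t * q' t - q t * p' t) * h / m - (p t * p t + q t * q t) / r t).
{ field; lra. }
rewrite Ht, HR. field; lra.
Qed.

(** * Mean anomaly, period and the constant of the third law *)

(* Kepler's equation [E - e sin E], with the eccentric anomaly [E] written in terms
   of the true anomaly; [k = sqrt (1 - e1^2 - e2^2)].  The [atan] form is smooth on
   the whole line and increases by [2 * PI] per turn. *)
Definition mean_anomaly (e1 e2 k a : R) : R :=
  a - 2 * atan ((e1 * sin a - e2 * cos a) / (1 + k + (e1 * cos a + e2 * sin a)))
    - k * ((e1 * sin a - e2 * cos a) / (1 + (e1 * cos a + e2 * sin a))).

(** Here [f' = - g] and [g' = f]. Eliminating [g^2] turns the denominator from the [atan] into
    [2 * (1 + k) * (1 + f)] and leaves a rational identity in [f] and [k]. Moreover [1 + f] is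
    positive because [f^2 <= 1 - k^2 < 1]. *)
Lemma mean_anomaly_derivative (e1 e2 k a : R) :
  0 < k -> e1 ^ 2 + e2 ^ 2 = 1 - k ^ 2 ->
  is_derive (mean_anomaly e1 e2 k) a (k ^ 3 / (1 + (e1 * cos a + e2 * sin a)) ^ 2).
Proof.
intros Hk He.
pose proof (sin2_cos2 a) as Ha. unfold Rsqr in Ha.
set (f := e1 * cos a + e2 * sin a). set (g := e1 * sin a - e2 * cos a).
assert (Hg : g ^ 2 = 1 - k ^ 2 - f ^ 2).
{ rewrite <- He. unfold f, g.
  transitivity ((e1 ^ 2 + e2 ^ 2) * (sin a * sin a + cos a * cos a)
    - (e1 * cos a + e2 * sin a) ^ 2); [ring|]. rewrite Ha; ring. }
assert (Hf : 0 < 1 + f) by nra.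
unfold mean_anomaly. auto_derive; fold f; fold g.
- lra.
- replace (e1 * (1 * cos a) + - (e2 * (1 * - sin a))) with f by (unfold f; ring).
  replace (- (e1 * (1 * - sin a) + e2 * (1 * cos a))) with g by (unfold g; ring).
  change (e1 * sin a + - (e2 * cos a)) with g.
  transitivity (1 - 2 * ((f * (1 + k + f) + g ^ 2) / ((1 + k + f) ^ 2 + g ^ 2))
    - k * ((f * (1 + f) + g ^ 2) / (1 + f) ^ 2)).
  { field. repeat split; nra. }
  rewrite Hg. field. repeat split; nra.
Qed.

(** Apart from the linear term [a], the mean anomaly depends only on [cos a] and [sin a]. *)
Lemma mean_anomaly_turn (e1 e2 k a b : R) :
  Rabs (b - a) = 2 * PI ->
  Rabs (mean_anomaly e1 e2 k b - mean_anomaly e1 e2 k a) = 2 * PI.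
Proof.
intro H. rewrite <- H. f_equal.
assert (Hb : cos b = cos a /\ sin b = sin a).
{ unfold Rabs in H. destruct Rcase_abs in H.
  - replace a with (b + 2 * PI) by lra. rewrite cos_plus, sin_plus, cos_2PI, sin_2PI. split; ring.
  - replace b with (a + 2 * PI) by lra. rewrite cos_plus, sin_plus, cos_2PI, sin_2PI. split; ring. }
unfold mean_anomaly. destruct Hb as [-> ->]. ring.
Qed.

(** By the chain rule the mean anomaly grows at the rate [k^3 / (1 + f)^2] times [h / r^2], with
    [f = e1 * cos th + e2 * sin th]; this is constant because [r * (1 + f) = l]. *)
Lemma kepler_period (h e1 e2 k l t0 T : R) (r th : R -> R) :
  0 < k -> e1 ^ 2 + e2 ^ 2 = 1 - k ^ 2 -> 0 < l -> 0 < T ->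
  (forall t, 0 < r t) ->
  (forall t, r t * (1 + (e1 * cos (th t) + e2 * sin (th t))) = l) ->
  (forall t, is_derive th t (h / (r t * r t))) ->
  Rabs (th (t0 + T) - th t0) = 2 * PI ->
  k ^ 3 * Rabs h / l ^ 2 * T = 2 * PI.
Proof.
intros Hk He Hl HT Hr Hrl Dth Hturn.
assert (Dm : forall t, is_derive (fun t => mean_anomaly e1 e2 k (th t)) t (k ^ 3 * h / l ^ 2)).
{ intro t. pose proof (Hr t).
  evar_last.
  - apply (is_derive_comp (mean_anomaly e1 e2 k) th).
    + now apply mean_anomaly_derivative.
    + apply Dth.
  - rewrite <- (Hrl t). unfold scal; simpl; unfold mult; simpl.
    pose proof (Hrl t).
    assert (1 + (e1 * cos (th t) + e2 * sin (th t)) <> 0) by nra.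
    field. split; [nra|lra]. }
apply (mean_anomaly_turn e1 e2 k) in Hturn.
rewrite (constant_derivative _ _ Dm t0 (t0 + T)) in Hturn.
rewrite <- Hturn.
replace (k ^ 3 * h / l ^ 2 * (t0 + T - t0)) with ((k ^ 3 / l ^ 2 * T) * h) by (field; lra).
rewrite Rabs_mult, (Rabs_pos_eq (k ^ 3 / l ^ 2 * T)).
- field; lra.
- assert (0 < k ^ 3 / l ^ 2) by (apply Rdiv_lt_0_compat; apply pow_lt; lra). nra.
Qed.

Lemma third_law_constant (m h k T : R) :
  0 < m -> h <> 0 -> 0 < k ->
  k ^ 3 * Rabs h / (h ^ 2 / m) ^ 2 * T = 2 * PI ->
  Rpower (2 * (h ^ 2 / m) / k ^ 2) (3 / 2) / T = sqrt (2 * m) / PI.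
Proof.
intros hm Hh Hk HT.
pose proof PI_RGT_0 as Hpi.
assert (Ha : 0 < Rabs h) by now apply Rabs_pos_lt.
(* Only [h^2] and [Rabs h] occur, so the sense of rotation disappears on passing to [j = Rabs h]. *)
rewrite <- (pow2_abs h) in *. set (j := Rabs h) in *. clearbody j.
assert (HT' : T = 2 * PI * (j ^ 2 / m) ^ 2 / (k ^ 3 * j)).
{ rewrite <- HT. field. lra. }
assert (HX : 0 < 2 * (j ^ 2 / m) / k ^ 2).
{ apply Rdiv_lt_0_compat; [|nra].
  apply Rmult_lt_0_compat; [lra|]. apply Rdiv_lt_0_compat; nra. }
replace (3 / 2) with (1 + / 2) by field.
rewrite Rpower_plus, Rpower_1, Rpower_sqrt by exact HX.
assert (Hs : sqrt (2 * (j ^ 2 / m) / k ^ 2) = sqrt (2 * m) * (j / (m * k))).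
{ replace (2 * (j ^ 2 / m) / k ^ 2) with (2 * m * (j / (m * k))²) by (unfold Rsqr; field; lra).
  rewrite sqrt_mult_alt by lra. rewrite sqrt_Rsqr; [reflexivity|].
  apply Rlt_le, Rdiv_lt_0_compat; nra. }
rewrite Hs, HT'. field. lra.
Qed.

(** * Eccentricity and apsides *)

(* Looking along the two directions of the eccentricity vector bounds it by [1] and
   locates the apsides. *)
Lemma kepler_ellipse (e1 e2 l : R) (r th : R -> R) :
  0 < l -> (forall t, 0 < r t) ->
  (forall t, r t * (1 + (e1 * cos (th t) + e2 * sin (th t))) = l) ->
  (forall c s, c * c + s * s = 1 -> exists t, cos (th t) = c /\ sin (th t) = s) ->
  exists k, 0 < k /\ e1 ^ 2 + e2 ^ 2 = 1 - k ^ 2 /\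
    (forall t, r t <= 2 * l / k ^ 2) /\
    exists t1 t2, cos (th t2) = - cos (th t1) /\ sin (th t2) = - sin (th t1) /\
      r t1 + r t2 = 2 * l / k ^ 2.
Proof.
intros Hl Hr Hrl Hdir.
assert (Hcs : exists e c s, 0 <= e /\ c * c + s * s = 1 /\ e1 = e * c /\ e2 = e * s).
{ destruct (Req_dec (e1 ^ 2 + e2 ^ 2) 0) as [E|E].
  (* For a circle any unit vector can serve as the direction of the eccentricity vector. *)
  - exists 0, 1, 0. repeat split; nra.
  - assert (P : 0 < sqrt (e1 ^ 2 + e2 ^ 2)) by (apply sqrt_lt_R0; nra).
    assert (Q : sqrt (e1 ^ 2 + e2 ^ 2) ^ 2 = e1 ^ 2 + e2 ^ 2) by (apply pow2_sqrt; nra).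
    set (e := sqrt _) in *.
    exists e, (e1 / e), (e2 / e). repeat split; [lra| |field; lra|field; lra].
    transitivity ((e1 ^ 2 + e2 ^ 2) / e ^ 2); [field; lra|]. rewrite <- Q. field; lra. }
destruct Hcs as (e & c & s & He & Hcs & -> & ->).
(* The directions [(c, s)] and [(- c, - s)] give the periapsis and the apoapsis:
   [r t1 * (1 + e) = l] and [r t2 * (1 - e) = l]. *)
destruct (Hdir c s Hcs) as (t1 & C1 & S1).
destruct (Hdir (- c) (- s)) as (t2 & C2 & S2); [lra|].
pose proof (Hrl t1) as R1. rewrite C1, S1 in R1.
replace (e * c * c + e * s * s) with (e * (c * c + s * s)) in R1 by ring. rewrite Hcs in R1.
pose proof (Hrl t2) as R2. rewrite C2, S2 in R2.
replace (e * c * - c + e * s * - s) with (- e * (c * c + s * s)) in R2 by ring. rewrite Hcs in R2.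
assert (e < 1) by (pose proof (Hr t2); nra).
assert (Hk : sqrt (1 - e ^ 2) ^ 2 = 1 - e ^ 2) by (apply pow2_sqrt; nra).
exists (sqrt (1 - e ^ 2)). rewrite Hk.
assert (Hsum : 2 * l / (1 - e ^ 2) = l / (1 + e) + l / (1 - e)) by (field; nra).
repeat split.
- apply sqrt_lt_R0; nra.
- transitivity (e ^ 2 * (c * c + s * s)); [ring|]. rewrite Hcs; ring.
- intro t. rewrite Hsum.
  assert (0 < l / (1 + e)) by (apply Rdiv_lt_0_compat; lra).
  enough (r t <= l / (1 - e)) by lra.
  apply Rle_div_r; [lra|]. pose proof (Hr t). rewrite <- (Hrl t).
  apply Rmult_le_compat_l; [lra|].
  pose proof (sin2_cos2 (th t)) as Ht. unfold Rsqr in Ht.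
  (* These squares give the lower Cauchy-Schwarz bound for the two unit vectors. *)
  pose proof (pow2_ge_0 (c + cos (th t))). pose proof (pow2_ge_0 (s + sin (th t))).
  assert (-1 <= c * cos (th t) + s * sin (th t)) by nra.
  nra.
- exists t1, t2. rewrite C1, S1, C2, S2, Hsum. repeat split.
  rewrite <- R1 at 1. rewrite <- R2 at 1. field. lra.
Qed.

(** * Vector computations in the orbital plane *)

Ltac r3_ring :=
  apply injective_projections; [apply injective_projections|];
  unfold minus, plus, opp, zero, scal; simpl; unfold plus, opp, zero, scal, mult; simpl;
  unfold mult; simpl; ring.

(** The base point [S] lets one statement serve both for positions relative to the centre and, with
    [S] equal to [zero], for velocities. *)
Lemma is_derive_dot (f : R -> R3) (t : R) (l S u : R3) :
  is_derive f t l -> is_derive (fun s => dot (minus (f s) S) u) t (dot l u).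
Proof.
intro Df.
assert (H1 : is_derive (fun s => fst (f s)) t (fst l)).
{ eapply filterdiff_ext_lin.
  - apply (filterdiff_comp' f fst t _ fst Df). apply filterdiff_linear, is_linear_fst.
  - intro y. reflexivity. }
assert (H3 : is_derive (fun s => snd (f s)) t (snd l)).
{ eapply filterdiff_ext_lin.
  - apply (filterdiff_comp' f snd t _ snd Df). apply filterdiff_linear, is_linear_snd.
  - intro y. reflexivity. }
assert (H11 : is_derive (fun s => fst (fst (f s))) t (fst (fst l))).
{ eapply filterdiff_ext_lin.
  - apply (filterdiff_comp' (fun s => fst (f s)) fst t _ fst H1).
    apply filterdiff_linear, is_linear_fst.
  - intro y. reflexivity. }
assert (H12 : is_derive (fun s => snd (fst (f s))) t (snd (fst l))).
{ eapply filterdiff_ext_lin.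
  - apply (filterdiff_comp' (fun s => fst (f s)) snd t _ snd H1).
    apply filterdiff_linear, is_linear_snd.
  - intro y. reflexivity. }
assert (H : forall (a b c : R -> R) (a' b' c' s1 s2 s3 u1 u2 u3 : R),
  is_derive a t a' -> is_derive b t b' -> is_derive c t c' ->
  is_derive (fun s => (a s - s1) * u1 + (b s - s2) * u2 + (c s - s3) * u3) t
    (a' * u1 + b' * u2 + c' * u3)).
{ intros * Da Db Dc. auto_derive; [repeat split; eexists; eauto|].
  change (Derive (fun s => a s) t) with (Derive a t).
  change (Derive (fun s => b s) t) with (Derive b t).
  change (Derive (fun s => c s) t) with (Derive c t).
  rewrite (is_derive_unique _ _ _ Da), (is_derive_unique _ _ _ Db), (is_derive_unique _ _ _ Dc).
  ring. }
exact (H _ _ _ _ _ _ (fst (fst S)) (snd (fst S)) (snd S) _ _ _ H11 H12 H3).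
Qed.

Lemma edist_orthonormal (u w P Q : R3) (a b : R) :
  dot u u = 1 -> dot w w = 1 -> dot u w = 0 ->
  minus P Q = plus (scal a u) (scal b w) -> edist P Q = sqrt (a ^ 2 + b ^ 2).
Proof.
intros Hu Hw Huw E. rewrite edist_dot, E. f_equal.
transitivity (a ^ 2 * dot u u + b ^ 2 * dot w w + 2 * (a * b) * dot u w).
- destruct u as [[u1 u2] u3], w as [[w1 w2] w3].
  unfold dot, plus, scal; simpl. unfold plus, scal, mult; simpl. unfold mult; simpl. ring.
- rewrite Hu, Hw, Huw. ring.
Qed.

Lemma dot_scal_l (a : R) (y u : R3) : dot (scal a y) u = a * dot y u.
Proof.
unfold dot, scal; simpl. unfold scal, mult; simpl. unfold mult; simpl. ring.
Qed.

Lemma dot_orthonormal_combination (u w y : R3) (r c s : R) :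
  dot u u = 1 -> dot w w = 1 -> dot u w = 0 ->
  y = scal r (plus (scal c u) (scal s w)) -> dot y u = r * c /\ dot y w = r * s.
Proof.
intros Hu Hw Huw ->.
assert (H : forall z, dot (scal r (plus (scal c u) (scal s w))) z =
  r * (c * dot u z + s * dot w z)).
{ intro z. unfold dot, plus, scal; simpl. unfold plus, scal, mult; simpl. unfold mult; simpl. ring. }
assert (Hwu : dot w u = 0) by (rewrite <- Huw; unfold dot; ring).
rewrite !H, Hu, Hw, Huw, Hwu. split; ring.
Qed.

(** One focus is [S]; the other lies at distance [b * e] from it, away from the periapsis, where
    [b = 2 * l / k^2] and [e] is the eccentricity. The conic equation and [b * k^2 = 2 * l] make the
    squared distance to it [(b - r)^2], and [r <= b] fixes the sign of the root. *)
Lemma conic_focal_sum (S u w P : R3) (e1 e2 k l r c s : R) :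
  dot u u = 1 -> dot w w = 1 -> dot u w = 0 ->
  0 < k -> e1 ^ 2 + e2 ^ 2 = 1 - k ^ 2 -> c ^ 2 + s ^ 2 = 1 ->
  r * (1 + (e1 * c + e2 * s)) = l -> 0 <= r <= 2 * l / k ^ 2 ->
  minus P S = scal r (plus (scal c u) (scal s w)) ->
  edist P S + edist P (plus S (scal (- (2 * l / k ^ 2)) (plus (scal e1 u) (scal e2 w))))
    = 2 * l / k ^ 2.
Proof.
intros Hu Hw Huw Hk He Hcs Hl Hr HP.
set (b := 2 * l / k ^ 2) in *.
assert (Hb : b * k ^ 2 = 2 * l) by (unfold b; field; lra).
rewrite (edist_orthonormal u w P S (r * c) (r * s)); trivial.
2: { rewrite HP, scal_distr_l, !scal_assoc. reflexivity. }
rewrite (edist_orthonormal u w P _ (r * c + b * e1) (r * s + b * e2)); trivial.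
2: { transitivity (plus (minus P S) (scal b (plus (scal e1 u) (scal e2 w)))).
  - r3_ring.
  - rewrite HP. r3_ring. }
replace ((r * c) ^ 2 + (r * s) ^ 2) with (r²)
  by (transitivity (r ^ 2 * (c ^ 2 + s ^ 2)); [rewrite Hcs; unfold Rsqr; ring|ring]).
replace ((r * c + b * e1) ^ 2 + (r * s + b * e2) ^ 2) with ((b - r)²).
- rewrite !sqrt_Rsqr by lra. ring.
- transitivity (r ^ 2 * (c ^ 2 + s ^ 2) + 2 * b * (r * (1 + (e1 * c + e2 * s)) - r)
    + b ^ 2 * (e1 ^ 2 + e2 ^ 2)); [|ring].
  rewrite Hcs, He, Hl.
  transitivity (r ^ 2 + b * (2 * l) - 2 * b * r + b ^ 2 - b * (b * k ^ 2)).
  + rewrite Hb. unfold Rsqr; ring.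
  + ring.
Qed.

(** * Kepler's third law *)

Theorem theorem13 (S : R3) (m : R) (hm : 0 < m) :
  exists M : R, 0 < M /\
    forall x : R -> R3,
      inverse_square_motion S m x ->
      is_ellipse (orbit x) ->
      forall X t0 T : R,
        major_axis_length (orbit x) X ->
        revolves_once S x t0 T ->
        Rpower X (3 / 2) / T = M.
Proof.
exists (sqrt (2 * m) / PI).
pose proof PI_RGT_0 as Hpi.
split.
{ apply Rdiv_lt_0_compat; [apply sqrt_lt_R0; lra|lra]. }
intros x [HxS (v & Dx & Dv)] _ X t0 T HX
  (HT & th & (Hth & u & w & Hu & Hw & Huw & Hpol) & Hturn & _).
set (r := fun t => edist (x t) S).
assert (Hr : forall t, 0 < r t).
{ intro t. unfold r, edist.
  destruct (norm_ge_0 (minus (x t) S)) as [H|H]; [exact H|].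
  exfalso. apply (HxS t). symmetry in H. apply norm_eq_zero in H.
  transitivity (plus (minus (x t) S) S); [r3_ring|]. rewrite H. r3_ring. }
assert (Hcs : forall t, cos (th t) ^ 2 + sin (th t) ^ 2 = 1).
{ intro t. rewrite <- (sin2_cos2 (th t)). unfold Rsqr. ring. }
set (p := fun t => dot (minus (x t) S) u). set (q := fun t => dot (minus (x t) S) w).
assert (Hp : forall t, p t = r t * cos (th t)).
{ intro t. apply (dot_orthonormal_combination u w _ _ _ _ Hu Hw Huw (Hpol t)). }
assert (Hq : forall t, q t = r t * sin (th t)).
{ intro t. apply (dot_orthonormal_combination u w _ _ _ _ Hu Hw Huw (Hpol t)). }
assert (Dp : forall t, is_derive p t (dot (v t) u)) by (intro; now apply is_derive_dot).
assert (Dq : forall t, is_derive q t (dot (v t) w)) by (intro; now apply is_derive_dot).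
assert (D2 : forall z t, is_derive (fun t => dot (v t) z) t
  (- m * (/ r t ^ 3 * dot (minus (x t) S) z))).
{ intros z t. pose proof (is_derive_dot v t _ zero z (Dv t)) as H.
  rewrite !dot_scal_l in H. revert H. apply is_derive_ext.
  intro s. apply (f_equal (fun y => dot y z)). r3_ring. }
destruct (kepler_conserved m p q (fun t => dot (v t) u) (fun t => dot (v t) w) r)
  as (h & e1 & e2 & Hh); trivial.
{ intro t. rewrite Hp, Hq.
  transitivity (r t ^ 2 * (cos (th t) ^ 2 + sin (th t) ^ 2)); [ring|]. rewrite Hcs; ring. }
assert (Dth : forall t, is_derive th t (h / (r t * r t))).
{ intro t. rewrite <- (proj1 (Hh t)).
  apply (polar_angle_derivative p q (fun t => dot (v t) u) (fun t => dot (v t) w) r th); trivial. }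
(* With zero angular momentum the angle would be constant, contradicting the full turn. *)
assert (Hh0 : h <> 0).
{ intros ->.
  rewrite (constant_derivative th 0) in Hturn.
  - rewrite Rmult_0_l, Rabs_R0 in Hturn. lra.
  - intro t. replace 0 with (0 / (r t * r t)); [apply Dth|]. apply Rdiv_0_l. }
set (l := h ^ 2 / m) in *.
assert (Hl : 0 < l) by (apply Rdiv_lt_0_compat; [apply pow2_gt_0, Hh0|lra]).
assert (Hrl : forall t, r t * (1 + (e1 * cos (th t) + e2 * sin (th t))) = l).
{ intro t. rewrite <- (proj2 (Hh t)), Hp, Hq. ring. }
destruct (kepler_ellipse e1 e2 l r th) as (k & Hk & He & Hrb & t1 & t2 & C & E & Hsum); trivial.
{ intros c s. now apply (full_turn_all_directions th t0 (t0 + T)). }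
assert (HX2 : X = 2 * l / k ^ 2).
{ apply major_axis_diameter in HX.
  destruct HX as (Hmax & P & Q & [a <-] & [b <-] & HPQ).
  apply Rle_antisym.
  (* Upper bound: all orbit points share the focal sum [2 * l / k^2], which bounds every chord. *)
  - rewrite <- HPQ.
    eapply edist_le_focal_sum;
      eapply (conic_focal_sum S u w _ e1 e2 k l); eauto using Rlt_le.
  (* Lower bound: the apsides lie in opposite directions from [S], so their distance is the sum of
     their radii. *)
  - rewrite <- Hsum.
    replace (r t1 + r t2) with (edist (x t1) (x t2)); [apply Hmax; eexists; reflexivity|].
    pose proof (Hr t1). pose proof (Hr t2).
    rewrite (edist_orthonormal u w _ _ ((r t1 + r t2) * cos (th t1)) ((r t1 + r t2) * sin (th t1)));
      trivial.
    + transitivity (sqrt ((r t1 + r t2)²)); [f_equal|apply sqrt_Rsqr; lra].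
      transitivity ((r t1 + r t2) ^ 2 * (cos (th t1) ^ 2 + sin (th t1) ^ 2)); [ring|].
      rewrite Hcs. unfold Rsqr; ring.
    + rewrite (minus_trans S), <- (opp_minus (x t2) S), !Hpol, C, E. fold (r t1) (r t2).
      r3_ring. }
rewrite HX2. apply third_law_constant; trivial.
now apply (kepler_period h e1 e2 k l t0 T r th).
Qed.
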